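(* Let $\Gamma=(G,\sigma)$ be a signed graph on $n$ vertices with edge weight $w$, vertex measure $\mu$ and potential $\kappa$, and assume $\kappa\ge 0$ (i.e. $\kappa_i\ge 0$ for all $i$). Let $1<p\le q$ and $1\le k\le n$. Then $$2^{-p}\lambda_k^{(p)}\ \ge\ 2^{-q}\lambda_k^{(q)}$$ and $$p\left(\frac{\lambda_k^{(p)}}{\mathcal D}\right)^{1/p}\ \le\ q\left(\frac{\lambda_k^{(q)}}{\mathcal D}\right)^{1/q},\qquad\text{where } \mathcal D:=\max_{1\le i\le n}\frac{2\kappa_i+\sum_{j\sim i}w_{ij}}{2\mu_i}.$$
   Context: $G=(V,E)$ is a finite undirected graph without self-loops, $V=\{1,\dots,n\}$, and $i\sim j$ means $\{i,j\}\in E$. A signed graph $\Gamma=(G,\sigma)$ has a signature $\sigma:E\to\{+1,-1\}$, $\sigma_{ij}:=\sigma(\{i,j\})$, and comes with an edge weight $w:E\to(0,\infty)$, a vertex measure $\mu:V\to(0,\infty)$ and a potential $\kappa:V\to\mathbb R$ (written $w_{ij},\mu_i,\kappa_i$). For $p\ge1$ and nonzero $f:V\to\mathbb R$, the Rayleigh quotient is $$\mathcal R_p^\sigma(f)=\frac{\sum_{\{i,j\}\in E}w_{ij}|f(i)-\sigma_{ij}f(j)|^p+\sum_{i=1}^n\kappa_i|f(i)|^p}{\sum_{i=1}^n\mu_i|f(i)|^p}.$$ Let $\mathcal S_p=\{f:V\to\mathbb R:\sum_i\mu_i|f(i)|^p=1\}$. For a closed symmetric ($B=-B$) set $B\subset\mathbb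 R^n\setminus\{0\}$, its Krasnoselskii genus $\gamma(B)$ is the least $k$ such that there is an odd continuous map $B\to\mathbb R^k\setminus\{0\}$ ($\infty$ if none). $\mathcal F_k(\mathcal S_p)$ is the family of closed symmetric $B\subset\mathcal S_p$ with $\gamma(B)\ge k$. The $k$-th variational eigenvalue of the $p$-Laplacian of $\Gamma$ is $\lambda_k^{(p)}=\lambda_k^{(p)}(\Gamma)=\min_{B\in\mathcal F_k(\mathcal S_p)}\max_{f\in B}\mathcal R_p^\sigma(f)$, $k=1,\dots,n$. *)

(* Defs.v *)
From HB Require Import structures.
From mathcomp Require Import all_boot all_order all_algebra.
From mathcomp Require Import all_classical all_reals all_analysis.
Set Implicit Arguments. Unset Strict Implicit. Unset Printing Implicit Defensive.
Import Order.TTheory GRing.Theory Num.Theory.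
Import numFieldNormedType.Exports.
Local Open Scope classical_set_scope.
Local Open Scope ring_scope.

(* Vertices are 'I_n; a function f : V -> R is a row vector f : 'rV[R]_n,
   with value f 0 i at vertex i.  The graph is given by a relation e
   (assumed symmetric and irreflexive in the theorem); sigma, w are
   functions of ordered pairs (assumed symmetric in the theorem). *)

Section Defs.
Variable R : realType.

Definition rayleigh n (p : R) (e : rel 'I_n) (sigma w : 'I_n -> 'I_n -> R)
  (mu kappa : 'I_n -> R) (f : 'rV[R]_n) : R :=
  ((\sum_(i < n) \sum_(j < n | (i < j)%N && e i j)
        w i j * `|f 0 i - sigma i j * f 0 j| `^ p)
   + \sum_(i < n) kappa i * `|f 0 i| `^ p)
  / (\sum_(i < n) mu i * `|f 0 i| `^ p).

Definition pSphere n (p : R) (mu : 'I_n -> R) : set 'rV[R]_n :=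
  [set f | \sum_(i < n) mu i * `|f 0 i| `^ p = 1].

Definition genus_ge n (B : set 'rV[R]_n) (k : nat) : Prop :=
  forall m : nat, (m < k)%N ->
    ~ exists g : 'rV[R]_n -> 'rV[R]_m,
        [/\ {within B, continuous g},
            (forall x, B x -> g (- x) = - g x) &
            (forall x, B x -> g x != 0)].

Definition genusFamily n (p : R) (mu : 'I_n -> R) (k : nat) : set (set 'rV[R]_n) :=
  [set B | [/\ B `<=` pSphere p mu, closed B,
              (forall x, B x -> B (- x)) & genus_ge B k]].

(* lambda_k^{(p)} = min_{B in F_k} max_{f in B} R_p(f), written as inf/sup
   (the min and max are attained, so they coincide with inf and sup). *)
Definition var_eig n (p : R) (e : rel 'I_n) (sigma w : 'I_n -> 'I_n -> R)
  (mu kappa : 'I_n -> R) (k : nat) : R :=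
  inf [set sup (rayleigh p e sigma w mu kappa @` B) | B in genusFamily p mu k].

(* D = max_i (2 kappa_i + sum_{j ~ i} w_ij) / (2 mu_i); the terms are >= 0
   when kappa >= 0, so folding Num.max from 0 gives the maximum. *)
Definition maxDeg n (e : rel 'I_n) (w : 'I_n -> 'I_n -> R) (mu kappa : 'I_n -> R) : R :=
  \big[Num.max/0]_(i < n)
     ((2 * kappa i + \sum_(j < n | e i j) w i j) / (2 * mu i)).

End Defs.

(* Main.v *)
Require Import Defs.
From mathcomp Require Import all_boot all_order all_algebra.
From mathcomp Require Import all_classical all_reals all_analysis.
From mathcomp Require Import ring lra.
Import Order.TTheory GRing.Theory Num.Theory.
Import numFieldNormedType.Exports.
Local Open Scope classical_set_scope.
Local Open Scope ring_scope.

(* With s = q / p, the Mazur map f_i |-> sgn(f_i) |f_i|^s is an odd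
   homeomorphism from S_q to S_p, so it matches the families F_k(S_q) and
   F_k(S_p), and it suffices to compare the Rayleigh quotients of f and of its
   image edge by edge.  The first bound follows from
     (|a - b| / 2)^s <= |phi a - phi b| / 2,   phi t = sgn(t) |t|^s,
   and the second one from
     |phi a - phi b| <= s |a - b| ((|a|^q + |b|^q) / 2)^((s - 1) / q)
   and Hoelder's inequality over the edges and vertices with exponents s and
   s / (s - 1), as sum_{i~j} w_ij (|f_i|^q + |f_j|^q) / 2 + sum_i kappa_i |f_i|^q
   is at most maxDeg on S_q. *)

(** * Elementary inequalities for real powers *)

Section RealInequalities.
Set Implicit Arguments.
Unset Strict Implicit.
Variable R : realType.
Implicit Types a b c p q r s t x y : R.

Lemma ler_powR2r r x y : 0 <= r -> 0 <= x -> x <= y -> x `^ r <= y `^ r.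
Proof.
move=> r0 x0 xy; apply: ge0_ler_powR => //; rewrite nnegrE //.
exact: le_trans xy.
Qed.

(** Young's inequality with exponents 1/t and 1/(1 - t); the endpoints, where one exponent is
    infinite, are checked apart. *)
Lemma weighted_amgm x y t : 0 <= x -> 0 <= y -> 0 <= t -> t <= 1 ->
  x `^ t * y `^ (1 - t) <= t * x + (1 - t) * y.
Proof.
move=> x0 y0; rewrite le_eqVlt => /predU1P[<- _|t0].
  by rewrite powRr0 !mul1r mul0r add0r subr0 powRr1 // mul1r.
rewrite le_eqVlt => /predU1P[->|t1].
  by rewrite subrr powRr0 mulr1 mul0r addr0 mul1r powRr1.
have t1' : 0 < 1 - t by rewrite subr_gt0.
have := @conjugate_powR R (x `^ t) (y `^ (1 - t)) t^-1 (1 - t)^-1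
  (powR_ge0 _ _) (powR_ge0 _ _).
rewrite !invr_gt0 t0 t1' !invrK subrKC => /(_ isT isT erefl).
rewrite -!powRrM !divff ?gt_eqF // !powRr1 //.
by rewrite [x * t]mulrC [y * _]mulrC.
Qed.

(** * Signed powers and their continuity *)

Definition spow r x : R := Num.sg x * `|x| `^ r.

Lemma spow_ge0 r x : r != 0 -> 0 <= x -> spow r x = x `^ r.
Proof.
move=> r0; rewrite /spow le_eqVlt => /predU1P[<-|x0].
  by rewrite sgr0 mul0r powR0.
by rewrite gtr0_sg // mul1r gtr0_norm.
Qed.

Lemma spowN r x : spow r (- x) = - spow r x.
Proof. by rewrite /spow sgrN normrN mulNr. Qed.

Lemma spow_sgM r e x : e = 1 \/ e = -1 -> spow r (e * x) = e * spow r x.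
Proof. by case=> ->; rewrite ?mulN1r ?spowN ?mul1r. Qed.

Lemma norm_spow r x : r != 0 -> `|spow r x| = `|x| `^ r.
Proof.
move=> r0; rewrite /spow normrM normr_sg (ger0_norm (powR_ge0 _ _)).
by have [->|_] := eqVneq x 0; rewrite /= ?mul1r // mul0r normr0 powR0.
Qed.

Lemma spowK r : r != 0 -> cancel (spow r) (spow r^-1).
Proof.
move=> r0 x; rewrite {1}/spow norm_spow // -powRrM divff // powRr1 //.
rewrite /spow sgrM sgr_id; have [->|x0] := eqVneq x 0; first by rewrite normr0 mulr0.
by rewrite (@gtr0_sg _ (_ `^ _)) ?powR_gt0 ?normr_gt0 // mulr1 -numEsg.
Qed.

Lemma continuous_powR_gt0 r x : 0 < x -> {for x, continuous (@powR R ^~ r)}.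
Proof.
move=> x0; apply: differentiable_continuous; apply/derivable1_diffP.
by apply: derivable_powR; rewrite in_itv /= x0.
Qed.

(** Away from 0 the sign is locally constant, so [spow r] is locally a constant times |t|^r; at 0
    only the size |t|^r matters. *)
Lemma continuous_spow r : 0 < r -> continuous (spow r).
Proof.
move=> r0 x; have [->|x0] := eqVneq x 0.
  rewrite /continuous_at {2}/spow sgr0 mul0r.
  apply/cvgr0Pnorm_lt => e e0; near=> t.
  rewrite norm_spow ?gt_eqF //.
  (* This makes e^(1/r) a radius that works around 0. *)
  have -> : e = (e `^ r^-1) `^ r by rewrite -powRrM mulVf ?gt_eqF // powRr1 // ltW.
  apply: gt0_ltr_powR => //; rewrite ?nnegrE ?powR_ge0 //.
  near: t; apply: (@cvgr0_norm_lt _ _ _ _ _ id) => //; last by rewrite powR_gt0.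
apply: (@cvg_trans _ ((fun t => Num.sg x * `|t| `^ r) @ x)).
  apply: near_eq_cvg; near=> t; rewrite /spow; congr (_ * _).
  have : `|t - x| < `|x|.
    near: t; apply: (@cvgr_distC_lt _ _ _ _ _ id x) => //; rewrite normr_gt0 x0 //.
  move: (x0); rewrite neq_lt => /orP[xl|xg].
    rewrite (ltr0_norm xl) ltr_norml => /andP[? ?].
    by rewrite !ltr0_sg //; lra.
  rewrite (gtr0_norm xg) ltr_norml => /andP[? ?].
  by rewrite !gtr0_sg //; lra.
apply: (@cvgM R R (nbhs x) _ (fun=> Num.sg x) (fun t => `|t| `^ r)); first exact: cvg_cst.
apply: (@continuous_comp _ _ _ (fun t : R => `|t|) (@powR R ^~ r)).
  exact: norm_continuous.
by apply: continuous_powR_gt0; rewrite normr_gt0.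
Unshelve. all: end_near. Qed.

(** The left endpoint may be 0, where the power need not be differentiable; on [a, b] it agrees with
    [spow r], which is continuous on the whole line. *)
Lemma within_continuous_powR r a b : 0 < r -> 0 <= a ->
  {within `[a, b], continuous (@powR R ^~ r)}.
Proof.
move=> r0 a0.
apply: (@subspace_eq_continuous _ _ _ (spow r)); last first.
  by apply: continuous_subspaceT; exact: continuous_spow.
move=> x; rewrite inE /= in_itv /= => /andP[ax _].
by rewrite /from_subspace spow_ge0 ?gt_eqF // (le_trans a0).
Qed.

(** * Convexity and integral estimates for powers *)

Lemma ler_is_derive (f df : R -> R) a b : a <= b ->
  (forall x, a < x -> x < b -> is_derive x 1 f (df x)) ->
  (forall x, a < x -> x < b -> 0 <= df x) ->
  {within `[a, b], continuous f} -> f a <= f b.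
Proof.
move=> ab fdf df0 fc; apply: (@ger0_derive1_ndecr _ f a b) => // x.
  by rewrite in_itv /= => /andP[ax xb]; have [] := fdf x ax xb.
rewrite in_itv /= => /andP[ax xb]; have ? := fdf x ax xb.
by rewrite derive1E derive_val df0.
Qed.

(** The graph of t^q lies above its tangent at x: y^q >= x^q + q x^(q - 1) (y - x), divided by q. It
    comes from weighted AM-GM with weight 1/q. *)
Lemma powR_tangent q x y : 1 <= q -> 0 <= x -> 0 <= y ->
  x `^ (q - 1) * y <= q^-1 * y `^ q + (1 - q^-1) * x `^ q.
Proof.
move=> q1 x0 y0; have q0 : 0 < q by lra.
have := @weighted_amgm (y `^ q) (x `^ q) q^-1 (powR_ge0 _ _) (powR_ge0 _ _).
rewrite invr_ge0 invf_le1 // => /(_ (ltW q0) q1).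
rewrite -!powRrM mulrBr mulr1 divff ?gt_eqF // powRr1 //.
by rewrite [_ * y]mulrC.
Qed.

(** Average the tangent inequalities at the midpoint [m], evaluated at [a] and at [b]. *)
Lemma powR_midpoint s a b : 1 <= s -> 0 <= a -> 0 <= b ->
  ((a + b) / 2) `^ s <= (a `^ s + b `^ s) / 2.
Proof.
move=> s1 a0 b0; have s0 : 0 < s by lra.
set m := (a + b) / 2; have m0 : 0 <= m by rewrite /m; lra.
have ta := powR_tangent s1 m0 a0; have tb := powR_tangent s1 m0 b0.
have mE := mulr_powRB1 m0 s0.
have : s^-1 * m `^ s <= s^-1 * ((a `^ s + b `^ s) / 2).
  have : 2 * m `^ s = m `^ (s - 1) * a + m `^ (s - 1) * b.
    by rewrite -mE /m; field.
  move: ta tb; rewrite !mulrBl !mul1r; lra.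
by rewrite ler_pM2l // invr_gt0.
Qed.

(** Split (x + y)^s as x (x + y)^(s - 1) + y (x + y)^(s - 1) and use x, y <= x + y. *)
Lemma powR_superadd s x y : 1 <= s -> 0 <= x -> 0 <= y ->
  x `^ s + y `^ s <= (x + y) `^ s.
Proof.
move=> s1 x0 y0; have s0 : 0 < s by lra.
have le z t : 0 <= z -> z <= t -> z `^ s <= z * t `^ (s - 1).
  move=> z0 zt; rewrite -[leLHS]mulr_powRB1 // ler_wpM2l // ler_powR2r //; lra.
rewrite -[leRHS]mulr_powRB1 ?addr_ge0 // mulrDl lerD //; apply: le; lra.
Qed.

(* Young's inequality t^(s - 1) C^(1 - h) <= h t^q + (1 - h) C, integrated
   over [b, a]. *)
Lemma powR_young_integrated q s h a b C : h = (s - 1) / q -> 1 <= s -> s - 1 <= q -> 0 < q -> 0 <= C ->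
  0 <= b -> b <= a ->
  C `^ (1 - h) * ((a `^ s - b `^ s) / s) <=
    h * ((a `^ (q + 1) - b `^ (q + 1)) / (q + 1)) + (1 - h) * C * (a - b).
Proof.
move=> hE s1 sq q0 C0 b0 ba.
have h0 : 0 <= h by rewrite hE divr_ge0 //; lra.
have h1 : h <= 1 by rewrite hE ler_pdivrMr //; lra.
pose f t := h * (t `^ (q + 1) / (q + 1)) + (1 - h) * C * t
  - C `^ (1 - h) * (t `^ s / s).
suff : f b <= f a by rewrite /f ![(_ - _) / _]mulrBl; lra.
pose df t := h * t `^ q + (1 - h) * C - t `^ (s - 1) * C `^ (1 - h).
apply: (@ler_is_derive f df) => //.
- move=> x bx _; have x0 : 0 < x by lra.
  have d1 := is_derive1_powR s x0.
  have d2 := is_derive1_powR (q + 1) x0.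
  apply: is_derive_eq; rewrite /df /GRing.scale /= addrK.
  by field; apply/andP; split; lra.
- move=> x bx _; rewrite subr_ge0.
  have := weighted_amgm (powR_ge0 x q) C0 h0 h1.
  by rewrite -powRrM [q * h]mulrC hE divfK ?gt_eqF.
- have cP r : 0 < r -> {within `[b, a], continuous (@powR R ^~ r)}.
    by move=> r0; exact: within_continuous_powR.
  move=> x; apply: cvgB; first apply: cvgD.
  + by apply: cvgMl_tmp; apply: cvgMr_tmp; apply: cP; lra.
  + apply: cvgMl_tmp.
    exact: (@continuous_subspaceT _ _ `[b, a]%classic id (fun y => cvg_id) x).
  + by apply: cvgMl_tmp; apply: cvgMr_tmp; apply: cP; lra.
Qed.

(** The trapezoid rule overestimates the integral of the convex function t^q over [b, a]: as a
    function of [a] the error vanishes at [b], and its derivative is nonnegative by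
    [powR_tangent]. *)
Lemma hermite_hadamard_powR q a b : 1 <= q -> 0 <= b -> b <= a ->
  (a `^ (q + 1) - b `^ (q + 1)) / (q + 1) <= (a - b) * ((a `^ q + b `^ q) / 2).
Proof.
move=> q1 b0 ba; have q0 : 0 < q by lra.
pose f t := (t - b) * ((t `^ q + b `^ q) / 2) - t `^ (q + 1) / (q + 1).
suff : f b <= f a.
  rewrite /f subrr mul0r sub0r.
  by rewrite [(_ - _) / _]mulrBl; lra.
pose df t := (t `^ q + b `^ q) / 2 + (t - b) * (q * t `^ (q - 1) / 2) - t `^ q.
apply: (@ler_is_derive f df) => //.
- move=> x bx _; have x0 : 0 < x by lra.
  have d1 := is_derive1_powR q x0.
  have d2 := is_derive1_powR (q + 1) x0.
  apply: is_derive_eq; rewrite /df /GRing.scale /= addrK.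
  by field; lra.
- move=> x bx _; have x0 : 0 < x by lra.
  rewrite /df.
  have := powR_tangent q1 (ltW x0) b0.
  rewrite -(ler_pM2l q0) mulrDr !mulrA divff ?gt_eqF // mul1r mulrBr mulr1 divff ?gt_eqF //.
  have := mulr_powRB1 (ltW x0) q0.
  set u := x `^ (q - 1); move=> <-; nra.
- have cP r : 0 < r -> {within `[b, a], continuous (@powR R ^~ r)}.
    by move=> r0; exact: within_continuous_powR.
  move=> x; apply: cvgB; first apply: cvgM; [apply: cvgB| |].
  + exact: (@continuous_subspaceT _ _ `[b, a]%classic id (fun y => cvg_id) x).
  + exact: cvg_cst.
  + apply: cvgMr_tmp; apply: cvgD; last exact: cvg_cst.
    exact: cP.
  + by apply: cvgMr_tmp; apply: cP; lra.
Qed.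

(** In the integrated Young inequality take C = (a^q + b^q) / 2: Hermite-Hadamard bounds its right
    side by C (a - b), and dividing by C^(1 - h) leaves the factor C^h. *)
Lemma powR_diff_le q s a b : 1 <= s -> s - 1 <= q -> 1 <= q ->
  0 <= b -> b <= a ->
  a `^ s - b `^ s <= s * (a - b) * ((a `^ q + b `^ q) / 2) `^ ((s - 1) / q).
Proof.
move=> s1 sq q1 b0 ba; set C := (_ / 2); set h := _ / q.
have q0 : 0 < q by lra.
have h0 : 0 <= h by rewrite divr_ge0 //; lra.
have [a0|a0] := eqVneq a 0.
  have -> : b = a by lra.
  by rewrite !subrr mulr0 mul0r.
have C0 : 0 < C.
  by rewrite divr_gt0 // ltr_wpDr ?powR_ge0 // powR_gt0 // lt_neqAle eq_sym a0; lra.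
have := powR_young_integrated (erefl h) s1 sq q0 (ltW C0) b0 ba => H.
have H' := ler_wpM2l h0 (hermite_hadamard_powR q1 b0 ba).
rewrite -/C in H'.
have E : C = C `^ (1 - h) * C `^ h.
  by rewrite -powRD ?subrK ?powRr1 ?ltW // gt_eqF ?implybT.
have : C `^ (1 - h) * ((a `^ s - b `^ s) / s) <= C `^ (1 - h) * (C `^ h * (a - b)).
  by rewrite [C `^ (1 - h) * (C `^ h * _)]mulrA -E; lra.
rewrite ler_pM2l ?powR_gt0 // ler_pdivrMr; last lra.
by move=> /le_trans; apply; lra.
Qed.

(** The counterpart for entries of opposite signs: Young's inequality is integrated over [0, a] and
    over [0, b] with the same C, and the results are added. *)
Lemma powR_add_le q s a b : 1 <= s -> s - 1 <= q -> 1 <= q ->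
  0 <= b -> 0 <= a ->
  a `^ s + b `^ s <= s * (a + b) * ((a `^ q + b `^ q) / 2) `^ ((s - 1) / q).
Proof.
move=> s1 sq q1 b0 a0; set C := (_ / 2); set h := _ / q.
have q0 : 0 < q by lra.
have h0 : 0 <= h by rewrite divr_ge0 //; lra.
have C0 : 0 <= C by rewrite divr_ge0 // addr_ge0 ?powR_ge0.
have [Cz|Cn] := eqVneq C 0.
  have [az bz] : a `^ q = 0 /\ b `^ q = 0.
    by have := powR_ge0 a q; have := powR_ge0 b q; move: Cz; rewrite /C; lra.
  rewrite (powR_eq0_eq0 az) (powR_eq0_eq0 bz) powR0; last lra.
  by rewrite !addr0 mulr0 mul0r.
have {Cn}C0' : 0 < C by rewrite lt_neqAle eq_sym Cn.
have := powR_young_integrated (erefl h) s1 sq q0 C0 (lexx 0) b0.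
have := powR_young_integrated (erefl h) s1 sq q0 C0 (lexx 0) a0.
rewrite !subr0 !powR0 ?subr0; [|lra|lra] => Ha Hb.
have sa : a `^ (q + 1) = a * a `^ q.
  by rewrite -[LHS]mulr_powRB1 //; [rewrite addrK|lra].
have sb : b `^ (q + 1) = b * b `^ q.
  by rewrite -[LHS]mulr_powRB1 //; [rewrite addrK|lra].
have H' : h * ((a `^ (q + 1) + b `^ (q + 1)) / (q + 1)) <= h * (C * (a + b)).
  rewrite ler_wpM2l // ler_pdivrMr; last lra.
  (* a a^q + b b^q <= (a + b) (a^q + b^q) = 2 C (a + b), and 2 <= q + 1. *)
  apply: (@le_trans _ _ (C * (a + b) * 2)).
    rewrite sa sb /C; have := powR_ge0 a q; have := powR_ge0 b q; nra.
  by apply: ler_wpM2l; [rewrite mulr_ge0 ?addr_ge0|lra].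
have E : C = C `^ (1 - h) * C `^ h.
  by rewrite -powRD ?subrK ?powRr1 // gt_eqF ?implybT.
have : C `^ (1 - h) * ((a `^ s + b `^ s) / s) <= C `^ (1 - h) * (C `^ h * (a + b)).
  move: H'; rewrite [C `^ (1 - h) * (C `^ h * _)]mulrA -E ![(_ + _) / _]mulrDl; lra.
rewrite ler_pM2l ?powR_gt0 // ler_pdivrMr; last lra.
by move=> /le_trans; apply; lra.
Qed.

(** * Differences of signed powers *)

Lemma wlog_signs (P : R -> R -> Prop) :
  (forall a b, P a b -> P b a) -> (forall a b, P a b -> P (- a) (- b)) ->
  (forall a b, 0 <= b -> b <= a -> P a b) ->
  (forall a b, 0 <= b -> 0 <= a -> P a (- b)) -> forall a b, P a b.
Proof.
move=> PC PN Pd Pa a b.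
have [a0|/ltW a0] := leP 0 a; have [b0|/ltW b0] := leP 0 b.
- by have [|/ltW] := leP b a => ?; [|apply: PC]; exact: Pd.
- by rewrite -[b]opprK; apply: Pa => //; lra.
- by apply: PC; rewrite -[a]opprK; apply: Pa => //; lra.
- rewrite -[a]opprK -[b]opprK; apply: PN.
  by have [|/ltW] := leP b a => ?; [apply: PC|]; apply: Pd; lra.
Qed.

Lemma spow_diff_le q s a b : 1 <= s -> s - 1 <= q -> 1 <= q ->
  `|spow s a - spow s b| <=
    s * `|a - b| * ((`|a| `^ q + `|b| `^ q) / 2) `^ ((s - 1) / q).
Proof.
move=> s1 sq q1; have s0 : s != 0 by lra.
move: a b; apply: wlog_signs => [a b|a b|a b b0 ba|a b b0 a0].
- by rewrite distrC [`|a - b|]distrC [_ + `|b| `^ q]addrC.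
- by rewrite !spowN -!opprD !normrN.
- have a0 : 0 <= a by lra.
  rewrite !spow_ge0 // !ger0_norm ?subr_ge0 // ?powR_diff_le //.
  by apply: ler_powR2r => //; lra.
- rewrite spowN !opprK normrN !spow_ge0 // !ger0_norm ?addr_ge0 ?powR_ge0 //.
  exact: powR_add_le.
Qed.

(** For opposite signs this is midpoint convexity. For equal signs, ((a - b) / 2)^s <= (a - b)^s / 2
    is convexity between a - b and 0, and (a - b)^s <= a^s - b^s is superadditivity. *)
Lemma spow_diff_ge s a b : 1 <= s ->
  (`|a - b| / 2) `^ s <= `|spow s a - spow s b| / 2.
Proof.
move=> s1; have s0 : s != 0 by lra.
move: a b; apply: wlog_signs => [a b|a b|a b b0 ba|a b b0 a0].
- by rewrite distrC [`|spow s a - _|]distrC.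
- by rewrite !spowN -!opprD !normrN.
- have a0 : 0 <= a by lra.
  rewrite !spow_ge0 // !ger0_norm ?subr_ge0 //; last by apply: ler_powR2r => //; lra.
  have := powR_midpoint s1 (_ : 0 <= a - b) (lexx 0).
  rewrite addr0 powR0 // addr0 subr_ge0 => /(_ ba) /le_trans; apply.
  have := powR_superadd s1 (_ : 0 <= a - b) b0.
  by rewrite subrK subr_ge0 => /(_ ba); lra.
- rewrite spowN !opprK !spow_ge0 // !ger0_norm ?addr_ge0 ?powR_ge0 //.
  exact: powR_midpoint.
Qed.

End RealInequalities.

(** * The Mazur map and the genus families *)

Section MazurMap.
Set Implicit Arguments.
Unset Strict Implicit.
Variables (R : realType) (n : nat).
Implicit Types (p q r s : R) (f x y : 'rV[R]_n) (mu : 'I_n -> R) (B : set 'rV[R]_n).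

Definition mazur s f : 'rV[R]_n := \row_i spow s (f 0 i).

Lemma mazurN s f : mazur s (- f) = - mazur s f.
Proof. by apply/rowP => i; rewrite !mxE spowN. Qed.

Lemma mazurK s : s != 0 -> cancel (mazur s) (mazur s^-1).
Proof. by move=> s0 f; apply/rowP => i; rewrite !mxE spowK. Qed.

Lemma mazurVK s : s != 0 -> cancel (mazur s^-1) (mazur s).
Proof. by move=> s0 f; rewrite -{1}[s]invrK mazurK ?invr_eq0. Qed.

Lemma norm_mazur p s f i : s != 0 -> `|mazur s f 0 i| `^ p = `|f 0 i| `^ (s * p).
Proof. by move=> s0; rewrite mxE norm_spow // powRrM. Qed.

(** A neighbourhood of a row vector contains a box of neighbourhoods of its finitely many entries,
    so continuity in each coordinate suffices. *)
Lemma continuous_mazur s : 0 < s -> continuous (mazur s).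
Proof.
move=> s0 f A [P fP PA].
have : \forall y \near (f : 'rV[R]_n), forall j, P 0 j (spow s ((y : 'rV[R]_n) 0 j)).
  apply: (@filter_forall _ _ (fun j (y : 'rV[R]_n) => P 0 j (spow s (y 0 j))) (nbhs f)) => j.
  have c : {for f, continuous (fun y : 'rV[R]_n => spow s (y 0 j))}.
    apply: (@continuous_comp _ _ _ (fun y : 'rV[R]_n => y 0 j) (spow s)).
      exact: coord_continuous.
    exact: continuous_spow.
  by apply: c; have := fP 0 j; rewrite mxE.
apply: filterS => y Py; apply: PA => i j.
by rewrite ord1 mxE.
Qed.

Lemma pSphere_mazur p s mu f : s != 0 ->
  pSphere p mu (mazur s f) <-> pSphere (s * p) mu f.
Proof.
move=> s0; rewrite /pSphere /=.
by under eq_bigr do rewrite norm_mazur //.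
Qed.

(** An odd nonvanishing map g on the preimage yields g composed with [mazur s^-1] on [B], so the
    genus cannot drop. *)
Lemma genus_ge_mazur B s k : 0 < s -> genus_ge B k -> genus_ge (mazur s @^-1` B) k.
Proof.
move=> s0 Bk m /Bk nB [g [gc godd gn0]]; apply: nB.
have sn0 : s != 0 by rewrite gt_eqF.
have BK y : B y -> (mazur s @^-1` B) (mazur s^-1 y) by rewrite /= mazurVK.
exists (g \o mazur s^-1); split => [|y /BK|y /BK] /=; last exact: gn0.
- apply/subspace_continuousP => y /BK By U gU.
  have H := (subspace_continuousP _ _).1 gc _ By U gU.
  have si0 : 0 < s^-1 by rewrite invr_gt0.
  have {}H : nbhs y [set z | (mazur s @^-1` B) (mazur s^-1 z) ->
      U (g (mazur s^-1 z))] := continuous_mazur si0 H.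
  change (nbhs y [set z | B z -> U (g (mazur s^-1 z))]).
  by apply: filterS H => z /= Hz /BK /Hz.
- by rewrite mazurN; exact: godd.
Qed.

(** Working with a preimage makes closedness follow directly from the continuity of [mazur s]. *)
Lemma genusFamily_mazur B p s mu k : 0 < s -> genusFamily p mu k B ->
  genusFamily (s * p) mu k (mazur s @^-1` B).
Proof.
move=> s0 [BS Bc Bsym Bk]; have sn0 : s != 0 by rewrite gt_eqF.
split => [f /BS /pSphere_mazur|||].
- exact.
- by apply: (continuous_closedP _).1 => //; exact: continuous_mazur.
- by move=> f /=; rewrite mazurN; exact: Bsym.
- exact: genus_ge_mazur.
Qed.

(** The empty set has genus 0, since the zero map to dimension 0 meets all conditions on it
    vacuously. *)
Lemma genusFamily_nonempty B p mu k : (0 < k)%N -> genusFamily p mu k B -> B !=set0.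
Proof.
move=> k0 [_ _ _ /(_ _ k0) Bk]; apply/set0P/eqP => B0; apply: Bk.
by exists (fun=> 0); split; rewrite B0 //; exact: continuous_subspace0.
Qed.

End MazurMap.

(** * Hoelder's inequality for finite sums *)

Section Hoelder.
Set Implicit Arguments.
Unset Strict Implicit.
Variable R : realType.
Implicit Types h x y : R.

(** Two-term Hoelder inequality with exponents 1/h and 1/(1 - h); at h = 1 the second is infinite
    and both sides are equal. *)
Lemma hoelder_add h x1 x2 y1 y2 : 0 < h -> h <= 1 ->
  0 <= x1 -> 0 <= x2 -> 0 <= y1 -> 0 <= y2 ->
  x1 `^ h * y1 `^ (1 - h) + x2 `^ h * y2 `^ (1 - h) <=
    (x1 + x2) `^ h * (y1 + y2) `^ (1 - h).
Proof.
move=> h0; rewrite le_eqVlt => /predU1P[->|h1] x10 x20 y10 y20.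
  by rewrite subrr !powRr0 !mulr1 !powRr1 // addr_ge0.
have h1' : 0 < 1 - h by rewrite subr_gt0.
have := @hoelder2 R (x1 `^ h) (x2 `^ h) (y1 `^ (1 - h)) (y2 `^ (1 - h)) h^-1 (1 - h)^-1
  (powR_ge0 _ _) (powR_ge0 _ _) (powR_ge0 _ _) (powR_ge0 _ _).
rewrite !invr_gt0 h0 h1' !invrK subrKC => /(_ isT isT erefl).
by rewrite -!powRrM !divff ?gt_eqF // !powRr1.
Qed.

Lemma powR_split h x : h != 0 -> 0 <= x -> x `^ h * x `^ (1 - h) = x.
Proof.
move=> h0 x0; have [->|xn] := eqVneq x 0; first by rewrite powR0 // mul0r.
by rewrite -powRD ?subrKC ?powRr1 // xn implybT.
Qed.

(** The sign conditions are bundled with the bound so that the relation is stable under addition;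
    Hoelder's inequality for nested sums then follows by induction. *)
Definition hoelder_bound h x y z := [/\ 0 <= x, 0 <= y & z <= x `^ h * y `^ (1 - h)].

Lemma hoelder_boundD h x y z x' y' z' : 0 < h -> h <= 1 ->
  hoelder_bound h x y z -> hoelder_bound h x' y' z' ->
  hoelder_bound h (x + x') (y + y') (z + z').
Proof.
move=> h0 h1 [x0 y0 zle] [x0' y0' zle']; split; rewrite ?addr_ge0 //.
exact: le_trans (lerD zle zle') (hoelder_add h0 h1 x0 x0' y0 y0').
Qed.

Lemma hoelder_bound_sum (I : Type) (r : seq I) (P : pred I) (X Y Z : I -> R) h :
  0 < h -> h <= 1 -> (forall i, P i -> hoelder_bound h (X i) (Y i) (Z i)) ->
  hoelder_bound h (\sum_(i <- r | P i) X i) (\sum_(i <- r | P i) Y i)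
    (\sum_(i <- r | P i) Z i).
Proof.
move=> h0 h1 H; apply: (big_ind3 (hoelder_bound h)); last exact: H.
  by split; rewrite ?mulr_ge0 ?powR_ge0.
by move=> *; exact: hoelder_boundD.
Qed.

End Hoelder.

(** * Energies of a function and of its Mazur image *)

Section Energy.
Set Implicit Arguments.
Unset Strict Implicit.
Variables (R : realType) (n : nat) (e : rel 'I_n).
Variables (sigma w : 'I_n -> 'I_n -> R) (mu kappa : 'I_n -> R).
Hypothesis e_sym : forall i j, e i j = e j i.
Hypothesis e_irr : forall i, ~~ e i i.
Hypothesis sigma1 : forall i j, e i j -> sigma i j = 1 \/ sigma i j = -1.
Hypothesis w_sym : forall i j, e i j -> w i j = w j i.
Hypothesis w_gt0 : forall i j, e i j -> 0 < w i j.
Hypothesis mu_gt0 : forall i, 0 < mu i.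
Hypothesis kappa_ge0 : forall i, 0 <= kappa i.
Implicit Types (p q r s : R) (f : 'rV[R]_n) (B : set 'rV[R]_n).

Definition energy p f : R :=
  (\sum_(i < n) \sum_(j < n | (i < j)%N && e i j)
     w i j * `|f 0 i - sigma i j * f 0 j| `^ p)
  + \sum_(i < n) kappa i * `|f 0 i| `^ p.

Lemma rayleigh_sphere p f : pSphere p mu f ->
  rayleigh p e sigma w mu kappa f = energy p f.
Proof. by rewrite /rayleigh => ->; rewrite divr1. Qed.

Lemma energy_ge0 p f : 0 <= energy p f.
Proof.
apply: addr_ge0; apply: sumr_ge0 => i _; last by rewrite mulr_ge0 ?powR_ge0.
by apply: sumr_ge0 => j /andP[_ /w_gt0 w0]; rewrite mulr_ge0 ?powR_ge0 ?ltW.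
Qed.

Lemma powR_half p (x : R) : 0 <= x -> 2 `^ (- p) * x `^ p = (x / 2) `^ p.
Proof.
by move=> x0; rewrite powRM ?invr_ge0 // mulrC -[2^-1]powR_inv1 // -powRrM mulN1r.
Qed.

(** The comparison is termwise: on edges [spow_diff_ge] is raised to the power p, at vertices the
    powers of |f_i| agree and 2^(-s p) <= 2^(-p). *)
Lemma energy_mazur_ge p s f : 1 <= s -> 0 < p ->
  2 `^ (- (s * p)) * energy (s * p) f <= 2 `^ (- p) * energy p (mazur s f).
Proof.
move=> s1 p0; have s0 : s != 0 by lra.
rewrite !mulrDr !mulr_sumr; apply: lerD; apply: ler_sum => i _; last first.
  rewrite norm_mazur // ler_wpM2r ?mulr_ge0 ?powR_ge0 //.
  by apply: ler_powR; [lra|nra].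
rewrite !mulr_sumr; apply: ler_sum => j /andP[_ eij].
rewrite ![2 `^ _ * (w i j * _)]mulrCA ler_pM2l ?w_gt0 //.
rewrite !powR_half // powRrM ler_powR2r ?powR_ge0 //; first lra.
(* The sign sigma_ij moves inside the odd function [spow s]. *)
by rewrite !mxE -(spow_sgM _ _ (sigma1 eij)) spow_diff_ge.
Qed.

Lemma norm_sphere p f i : pSphere p mu f -> `|f 0 i| `^ p <= (mu i)^-1.
Proof.
rewrite /pSphere /= => fS; rewrite -[leRHS]mul1r ler_pdivlMr // mulrC -fS.
rewrite (bigD1 i) //= lerDl; apply: sumr_ge0 => j _.
by rewrite mulr_ge0 ?powR_ge0 // ltW.
Qed.

(** Makes [sup] meaningful. By [energy_mazur_ge] with exponents p and 1, the p-energy of f is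
    controlled by the 1-energy of [mazur p f], whose entries are at most 1 / mu_i in absolute
    value. *)
Lemma rayleigh_bounded p B : 1 <= p -> B `<=` pSphere p mu ->
  has_ubound (rayleigh p e sigma w mu kappa @` B).
Proof.
move=> p1 BS; exists (2 `^ p * (2 `^ (- 1) * (
   (\sum_(i < n) \sum_(j < n | (i < j)%N && e i j)
     w i j * ((mu i)^-1 + (mu j)^-1))
  + \sum_(i < n) kappa i * (mu i)^-1))).
move=> _ [f /BS fS <-]; rewrite rayleigh_sphere //.
have := energy_mazur_ge f p1 ltr01.
rewrite mulr1 powRN [_^-1 * _]mulrC ler_pdivrMr ?powR_gt0 // [_ * 2 `^ p]mulrC.
move/le_trans; apply; rewrite ler_wpM2l ?powR_ge0 // ler_wpM2l ?powR_ge0 //.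
have p0 : p != 0 by lra.
have le_mu i : `|mazur p f 0 i| <= (mu i)^-1.
  by rewrite -[leLHS]powRr1 // norm_mazur // mulr1 norm_sphere.
apply: lerD; apply: ler_sum => i _; last by rewrite powRr1 // ler_wpM2l.
apply: ler_sum => j /andP[_ eij]; rewrite powRr1 // ler_pM2l ?w_gt0 //.
apply: le_trans (ler_normB _ _) _; apply: lerD => //; rewrite normrM.
by have [->|->] := sigma1 eij; rewrite ?normrN normr1 mul1r.
Qed.

(** Double counting: the left side sees each edge once, through i < j; the right side sees it from
    both ends with half weight. *)
Lemma edge_sum_half (F : 'I_n -> R) :
  \sum_(i < n) \sum_(j < n | (i < j)%N && e i j) w i j * ((F i + F j) / 2) =
  \sum_(i < n) F i * ((\sum_(j < n | e i j) w i j) / 2).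
Proof.
have -> : \sum_(i < n) F i * ((\sum_(j < n | e i j) w i j) / 2) =
  \sum_(i < n) \sum_(j < n | (i < j)%N && e i j) w i j * (F i / 2) +
  \sum_(i < n) \sum_(j < n | (j < i)%N && e i j) w i j * (F i / 2).
  rewrite -big_split /=; apply: eq_bigr => i _.
  rewrite (bigID (fun j : 'I_n => (i < j)%N)) /= mulrDl mulrDr.
  rewrite !mulr_suml !mulr_sumr; congr (_ + _); apply: eq_big => j.
  - by rewrite andbC.
  - by move=> _; ring.
  (* In the absence of loops, a neighbour j of i with j <= i satisfies j < i. *)
  - rewrite -leqNgt andbC; case eij: (e i j); rewrite ?andbF // !andbT ltn_neqAle.
    by case: eqP => // ij; move: eij; rewrite (ord_inj ij) (negbTE (e_irr _)).
  - by move=> _; ring.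
(* Exchanging the sums and using symmetry of [e] and [w] turns the half with j < i into a sum over i
   < j. *)
rewrite [X in _ = _ + X](exchange_big_dep xpredT) //= -big_split /=.
apply: eq_bigr => i _.
rewrite [X in _ = _ + X](eq_big (fun j : 'I_n => (i < j)%N && e i j)
  (fun j : 'I_n => w i j * (F j / 2))).
- by rewrite -big_split; apply: eq_bigr => j _ /=; ring.
- by move=> j; rewrite e_sym.
- by move=> j /andP[_ eji]; rewrite w_sym.
Qed.

(** By double counting the coefficient of F_i is kappa_i + (sum_j w_ij) / 2, which is mu_i times the
    i-th term of the maximum. *)
Lemma maxDeg_sum_le (F : 'I_n -> R) : (forall i, 0 <= F i) ->
  \sum_(i < n) \sum_(j < n | (i < j)%N && e i j) w i j * ((F i + F j) / 2)
    + \sum_(i < n) kappa i * F i <= maxDeg e w mu kappa * \sum_(i < n) mu i * F i.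
Proof.
move=> F0; rewrite edge_sum_half -big_split mulr_sumr; apply: ler_sum => i _ /=.
rewrite [leRHS]mulrA [kappa i * _]mulrC -mulrDr [leRHS]mulrC ler_wpM2l //.
have := @le_bigmax _ _ _ 0 (fun i => (2 * kappa i + \sum_(j < n | e i j) w i j) / (2 * mu i)) i.
rewrite -/(maxDeg e w mu kappa) ler_pdivrMr ?mulr_gt0 //.
by have := mu_gt0 i; lra.
Qed.

(** This is the p-th power of [spow_diff_le] at q = s p: the mean gets the exponent p (s - 1) / (s
    p) = 1 - 1/s, and c splits as c^(1/s) c^(1 - 1/s). *)
Lemma hoelder_bound_edge p s (c a b : R) : 1 <= s -> 1 <= p -> 0 <= c ->
  hoelder_bound s^-1 (s `^ (s * p) * (c * `|a - b| `^ (s * p)))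
    (c * ((`|a| `^ (s * p) + `|b| `^ (s * p)) / 2))
    (c * `|spow s a - spow s b| `^ p).
Proof.
move=> s1 p1 c0; have s0 : 0 < s by lra.
have sn0 : s != 0 by lra.
have M0 : 0 <= (`|a| `^ (s * p) + `|b| `^ (s * p)) / 2.
  by rewrite divr_ge0 ?addr_ge0 ?powR_ge0.
split; rewrite ?mulr_ge0 ?powR_ge0 //.
set M := (_ / 2) in M0 *.
have -> : (s `^ (s * p) * (c * `|a - b| `^ (s * p))) `^ s^-1 * (c * M) `^ (1 - s^-1)
    = c * (s * `|a - b| * M `^ ((s - 1) / (s * p))) `^ p.
  rewrite !powRM ?mulr_ge0 ?powR_ge0 ?(ltW s0) //.
  rewrite -!powRrM.
  have -> : s * p / s = p by field.
  have -> : (s - 1) / (s * p) * p = 1 - s^-1 by field; lra.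
  have h0 : s^-1 != 0 by rewrite invr_eq0.
  by rewrite -[c in RHS](powR_split h0 c0); ring.
rewrite ler_wpM2l // ler_powR2r //; first lra.
by apply: spow_diff_le => //; nra.
Qed.

Lemma energy_mazur_le p s f : 1 <= s -> 1 <= p -> pSphere (s * p) mu f ->
  energy p (mazur s f) <=
    (s `^ (s * p) * energy (s * p) f) `^ s^-1 * maxDeg e w mu kappa `^ (1 - s^-1).
Proof.
move=> s1 p1 fS; have s0 : 0 < s by lra.
have h0 : 0 < s^-1 by rewrite invr_gt0.
have h1 : s^-1 <= 1 by rewrite invf_le1.
have H : hoelder_bound s^-1 (s `^ (s * p) * energy (s * p) f)
  (\sum_(i < n) \sum_(j < n | (i < j)%N && e i j)
     w i j * ((`|f 0 i| `^ (s * p) + `|f 0 j| `^ (s * p)) / 2)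
    + \sum_(i < n) kappa i * `|f 0 i| `^ (s * p)) (energy p (mazur s f)).
  rewrite mulrDr !mulr_sumr; apply: hoelder_boundD => //; apply: hoelder_bound_sum => // i _.
    rewrite mulr_sumr; apply: hoelder_bound_sum => // j /andP[_ eij].
    have := @hoelder_bound_edge p s (w i j) (f 0 i) (sigma i j * f 0 j) s1 p1 (ltW (w_gt0 eij)).
    rewrite (spow_sgM _ _ (sigma1 eij)) !mxE.
    suff -> : `|sigma i j * f 0 j| = `|f 0 j| by [].
    by rewrite normrM; have [->|->] := sigma1 eij; rewrite ?normrN normr1 mul1r.
  have h0' : s^-1 != 0 by rewrite invr_eq0 gt_eqF.
  have k0 : 0 <= kappa i * `|f 0 i| `^ (s * p) by rewrite mulr_ge0 ?powR_ge0.
  rewrite norm_mazur ?gt_eqF //; split; rewrite ?mulr_ge0 ?powR_ge0 //.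
  (* At a vertex the prefactor is mere surplus: (s^(s p))^(1/s) = s^p >= 1. *)
  rewrite powRM ?powR_ge0 // -mulrA powR_split // ler_peMl //.
  rewrite -powRrM -(powRr0 s) ler_powR //.
  by rewrite mulrAC divff ?mul1r ?gt_eqF //; lra.
case: H => X0 Y0 /le_trans; apply; rewrite ler_wpM2l ?powR_ge0 // ler_powR2r //.
  by rewrite subr_ge0.
apply: le_trans (maxDeg_sum_le _) _; first by move=> i; exact: powR_ge0.
by rewrite (fS : \sum_(i < n) mu i * `|f 0 i| `^ (s * p) = 1) mulr1.
Qed.

End Energy.

(** * From the Hoelder bound to scaled roots *)

Section Rescaling.
Set Implicit Arguments.
Unset Strict Implicit.
Variable R : realType.
Implicit Types p q s u v D : R.

(** Raising to the power s gives u^s <= s^q v D^(s - 1). Isolating v yields a lower bound that can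
    pass to an infimum over v. *)
Lemma rescale_powR_le s q u v D : 0 < s -> 0 <= u -> 0 <= v -> 0 < D ->
  u <= (s `^ q * v) `^ s^-1 * D `^ (1 - s^-1) ->
  D * ((u / D) `^ s / s `^ q) <= v.
Proof.
move=> s0 u0 v0 D0; have sn0 : s != 0 by rewrite gt_eqF.
move/(ler_powR2r (ltW s0) u0).
rewrite powRM ?powR_ge0 // -!powRrM mulVf // powRr1 ?mulr_ge0 ?powR_ge0 //.
rewrite mulrBl mulVf // mul1r.
have -> : (u / D) `^ s = u `^ s / (D * D `^ (s - 1)).
  rewrite powRM ?invr_ge0 ?(ltW D0) // mulr_powRB1 ?(ltW D0) //.
  by rewrite -[D^-1]powR_inv1 ?(ltW D0) // -powRrM mulN1r powRN.
have Y0 : 0 < D `^ (s - 1) by rewrite powR_gt0.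
have Z0 : 0 < s `^ q by rewrite powR_gt0.
move: (u `^ s) (D `^ _) (s `^ _) Y0 Z0 => X Y Z Y0 Z0 XZ.
have -> : D * (X / (D * Y) / Z) = X / (Y * Z) by field; rewrite !gt_eqF.
by rewrite ler_pdivrMr ?mulr_gt0 //; apply: le_trans XZ _; lra.
Qed.

Lemma le_rescale_powR p s u v D : 0 < p -> 0 < s -> 0 <= u -> 0 <= v -> 0 <= D ->
  (0 < D -> D * ((u / D) `^ s / s `^ (s * p)) <= v) ->
  p * (u / D) `^ p^-1 <= s * p * (v / D) `^ (s * p)^-1.
Proof.
move=> p0 s0 u0 v0; have q0 : 0 < s * p by rewrite mulr_gt0.
(* For D = 0 division returns 0 and both sides vanish; otherwise the (s p)-th root of the premise is
   taken. *)
rewrite le_eqVlt => /predU1P[<- _|D0 /(_ D0)].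
  by rewrite invr0 !mulr0 !powR0 ?invr_eq0 ?gt_eqF // !mulr0.
have -> : D * ((u / D) `^ s / s `^ (s * p)) = (s `^ (s * p))^-1 * (u / D) `^ s * D by ring.
rewrite -ler_pdivlMr // ler_pdivrMl ?powR_gt0 //.
have x0 : 0 <= u / D by rewrite divr_ge0 // ltW.
have y0 : 0 <= v / D by rewrite divr_ge0 // ltW.
have qV : 0 <= (s * p)^-1 by rewrite invr_ge0 ltW.
move/(ler_powR2r qV (powR_ge0 _ _)).
rewrite [leRHS]powRM ?powR_ge0 // -!powRrM divff ?gt_eqF // powRr1 ?(ltW s0) //.
have -> : s * (s * p)^-1 = p^-1 by field; rewrite !gt_eqF.
by move=> H; rewrite -mulrA mulrCA ler_pM2l.
Qed.

End Rescaling.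

(** * Comparison of the variational eigenvalues *)

Section Eigenvalues.
Set Implicit Arguments.
Unset Strict Implicit.
Variables (R : realType) (n : nat) (e : rel 'I_n).
Variables (sigma w : 'I_n -> 'I_n -> R) (mu kappa : 'I_n -> R) (k : nat).
Hypothesis e_sym : forall i j, e i j = e j i.
Hypothesis e_irr : forall i, ~~ e i i.
Hypothesis sigma1 : forall i j, e i j -> sigma i j = 1 \/ sigma i j = -1.
Hypothesis w_sym : forall i j, e i j -> w i j = w j i.
Hypothesis w_gt0 : forall i j, e i j -> 0 < w i j.
Hypothesis mu_gt0 : forall i, 0 < mu i.
Hypothesis kappa_ge0 : forall i, 0 <= kappa i.
Hypothesis k_gt0 : (0 < k)%N.
Implicit Types (p q r s c : R) (f : 'rV[R]_n) (B : set 'rV[R]_n).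

Local Notation E := (energy e sigma w kappa).
Local Notation eig p := (var_eig p e sigma w mu kappa k).
Local Notation maxR p B := (sup (rayleigh p e sigma w mu kappa @` B)).
Local Notation F p := (genusFamily p mu k).

Lemma energy_le_sup p B f : 1 <= p -> F p B -> B f -> E p f <= maxR p B.
Proof.
move=> p1 [BS _ _ _] Bf; rewrite -(rayleigh_sphere e sigma w kappa (BS _ Bf)).
by apply: ub_le_sup; [exact: rayleigh_bounded|exists f].
Qed.

Lemma sup_le_energy p B c : F p B -> (forall f, B f -> E p f <= c) -> maxR p B <= c.
Proof.
move=> FB Bc; apply: ge_sup.
  by have [f Bf] := genusFamily_nonempty k_gt0 FB; exists (rayleigh p e sigma w mu kappa f), f.
move=> _ [f Bf <-]; have [BS _ _ _] := FB.
by rewrite rayleigh_sphere ?Bc //; exact: BS.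
Qed.

Lemma sup_rayleigh_ge0 p B : 1 <= p -> F p B -> 0 <= maxR p B.
Proof.
move=> p1 FB; have [f Bf] := genusFamily_nonempty k_gt0 FB.
by apply: le_trans (energy_le_sup p1 FB Bf); exact: energy_ge0.
Qed.

Lemma var_eig_le p B : 1 <= p -> F p B -> eig p <= maxR p B.
Proof.
move=> p1 FB; apply: ge_inf; last by exists B.
by exists 0 => _ [C FC <-]; exact: sup_rayleigh_ge0.
Qed.

Lemma le_var_eig p c : F p !=set0 -> (forall B, F p B -> c <= maxR p B) -> c <= eig p.
Proof.
move=> [B FB] Fc; apply: lb_le_inf; first by exists (maxR p B), B.
by move=> _ [C FC <-]; exact: Fc.
Qed.

(** [inf] has the default value 0 on the empty set. Together with [genusFamily_set0] this settles
    the comparisons when the family is empty. *)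
Lemma var_eig_set0 p : F p = set0 -> eig p = 0.
Proof. by rewrite /var_eig => ->; rewrite image_set0 inf0. Qed.

Lemma genusFamily_set0 p s : 0 < s -> F p = set0 -> F (s * p) = set0.
Proof.
move=> s0 F0; apply/seteqP; split => // B FB.
have si0 : 0 < s^-1 by rewrite invr_gt0.
have := genusFamily_mazur si0 FB.
by rewrite mulrA mulVf ?gt_eqF // mul1r F0.
Qed.

(** The preimage of each B in [F p] under [mazur s] competes for the eigenvalue at s p, and
    [mazur s] sends its points into B, where [energy_mazur_ge] applies. *)
Lemma var_eig_mazur_ge p s : 1 <= s -> 1 <= p ->
  2 `^ (- (s * p)) * eig (s * p) <= 2 `^ (- p) * eig p.
Proof.
move=> s1 p1; have s0 : 0 < s by lra.
have q1 : 1 <= s * p by nra.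
have [F0|/set0P Fn0] := eqVneq (F p) set0.
  by rewrite !var_eig_set0 ?mulr0 //; exact: genusFamily_set0.
rewrite -ler_pdivrMl ?powR_gt0 //; apply: le_var_eig => // B FB.
have FB' := genusFamily_mazur s0 FB.
rewrite ler_pdivrMl ?powR_gt0 // -ler_pdivlMl ?powR_gt0 //.
apply: le_trans (var_eig_le q1 FB') _; apply: sup_le_energy => // f Bf.
rewrite ler_pdivlMl ?powR_gt0 //.
have p0 : 0 < p by lra.
apply: le_trans (energy_mazur_ge sigma1 w_gt0 kappa_ge0 f s1 p0) _.
by rewrite ler_pM2l ?powR_gt0 //; exact: energy_le_sup.
Qed.

Lemma var_eig_mazur_le p s : 1 <= s -> 1 <= p ->
  p * (eig p / maxDeg e w mu kappa) `^ p^-1 <=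
    s * p * (eig (s * p) / maxDeg e w mu kappa) `^ (s * p)^-1.
Proof.
move=> s1 p1; have s0 : 0 < s by lra.
have p0 : 0 < p by lra.
have q1 : 1 <= s * p by nra.
have [F0|/set0P Fn0] := eqVneq (F p) set0.
  rewrite !var_eig_set0 ?mul0r ?powR0 ?invr_eq0 ?gt_eqF ?mulr0 ?mulr_gt0 //.
  exact: genusFamily_set0.
have Fq0 : F (s * p) !=set0.
  by have [B FB] := Fn0; exists (mazur s @^-1` B); exact: genusFamily_mazur.
have eig0 r : F r !=set0 -> 1 <= r -> 0 <= eig r.
  by move=> Fr r1; apply: le_var_eig => // B FB; exact: sup_rayleigh_ge0.
(* With the eigenvalue at s p isolated, the bound can be checked for one B in [F (s * p)] at a
   time. *)
apply: le_rescale_powR => //; [exact: eig0|exact: eig0|exact: bigmax_ge_id|move=> D0].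
apply: le_var_eig => // B FB; apply: rescale_powR_le => //.
- exact: eig0.
- exact: sup_rayleigh_ge0.
have sV0 : 0 < s^-1 by rewrite invr_gt0.
have sn0 : s != 0 by rewrite gt_eqF.
have := genusFamily_mazur sV0 FB; rewrite mulrA mulVf // mul1r => FB'.
apply: le_trans (var_eig_le p1 FB') _; apply: sup_le_energy => // g Bg.
(* The competitor at exponent p is the preimage of B under [mazur s^-1], so g is the Mazur image of
   a point of B. *)
rewrite -[g](mazurVK sn0).
apply: le_trans (energy_mazur_le e_sym e_irr sigma1 w_sym w_gt0 mu_gt0 kappa_ge0 s1 p1 _) _.
  by have [BS _ _ _] := FB; exact: BS.
rewrite ler_wpM2r ?powR_ge0 // ler_powR2r ?(ltW sV0) //.
  by rewrite mulr_ge0 ?powR_ge0 ?energy_ge0.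
by rewrite ler_wpM2l ?powR_ge0 //; exact: energy_le_sup.
Qed.

End Eigenvalues.

Theorem theorem3p1 (R : realType) (n : nat) (e : rel 'I_n)
  (sigma w : 'I_n -> 'I_n -> R) (mu kappa : 'I_n -> R) (p q : R) (k : nat) :
  (forall i j, e i j = e j i) ->
  (forall i, ~~ e i i) ->
  (forall i j, e i j -> sigma i j = sigma j i) ->
  (forall i j, e i j -> sigma i j = 1 \/ sigma i j = -1) ->
  (forall i j, e i j -> w i j = w j i) ->
  (forall i j, e i j -> 0 < w i j) ->
  (forall i, 0 < mu i) ->
  (forall i, 0 <= kappa i) ->
  1 < p -> p <= q ->
  (1 <= k)%N -> (k <= n)%N ->
  2 `^ (- q) * var_eig q e sigma w mu kappa k
    <= 2 `^ (- p) * var_eig p e sigma w mu kappa k /\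
  p * (var_eig p e sigma w mu kappa k / maxDeg e w mu kappa) `^ (p^-1)
    <= q * (var_eig q e sigma w mu kappa k / maxDeg e w mu kappa) `^ (q^-1).
Proof.
move=> e_sym e_irr _ sigma1 w_sym w_gt0 mu_gt0 kappa_ge0 p1 pq k0 _.
have p0 : 0 < p by lra.
have s1 : 1 <= q / p by rewrite ler_pdivlMr // mul1r.
have <- : q / p * p = q by rewrite divfK // gt_eqF.
by split; [apply: var_eig_mazur_ge|apply: var_eig_mazur_le] => //; exact: ltW.
Qed.
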